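(* For $n \geq 5$, let $\delta_n$ be the hyperbolic distance between the top and bottom faces of the Löbell polyhedron $L_n \subset \mathbb{H}^3$. Then $\delta_n \to 0$ as $n \to \infty$.
   Context: For $n \geq 5$, consider the combinatorial $3$-polyhedron with $2n+2$ faces whose ''top'' and ''bottom'' faces are $n$-gons and whose lateral surface consists of $2n$ pentagons: $n$ upper pentagons $U_i$ and $n$ lower pentagons $V_i$ ($i \in \mathbb{Z}/n$), where $U_i$ is adjacent to the top face, $U_{i\pm 1}$, $V_i$ and $V_{i+1}$, and $V_i$ is adjacent to the bottom face, $V_{i\pm1}$, $U_{i-1}$ and $U_i$. By Andreev's theorem it is realized, uniquely up to isometry, as a compact polyhedron $L_n \subset \mathbb{H}^3$ all of whose dihedral angles are $\pi/2$; this is the Löbell polyhedron $L_n$. *)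

(* Defs.v *)
From HB Require Import structures.
From mathcomp Require Import all_boot all_order all_algebra.
From mathcomp Require Import all_classical all_reals all_analysis.

Set Implicit Arguments.
Unset Strict Implicit.
Unset Printing Implicit Defensive.

Import Order.TTheory GRing.Theory Num.Theory.
Import numFieldNormedType.Exports.

Local Open Scope classical_set_scope.
Local Open Scope ring_scope.

(* Hyperboloid model of H^3 in R^{3,1}; coordinate 0 is the timelike one. *)
Definition lorentz (R : realType) (x y : 'rV[R]_4) : R :=
  \sum_(i < 3) x 0 (lift ord0 i) * y 0 (lift ord0 i) - x 0 0 * y 0 0.

Definition H3 (R : realType) : set 'rV[R]_4 :=
  [set x | lorentz x x = -1 /\ 0 < x 0 0].

Definition arcosh (R : realType) (t : R) : R := ln (t + Num.sqrt (t ^+ 2 - 1)).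

Definition hdist (R : realType) (x y : 'rV[R]_4) : R := arcosh (- lorentz x y).

Definition hset_dist (R : realType) (A B : set 'rV[R]_4) : R :=
  inf [set d | exists x y, [/\ A x, B y & d = hdist x y]].

Definition has_free (R : realType) (S : set 'rV[R]_4) (k : nat) : Prop :=
  exists A : 'M[R]_(k, 4), row_free A /\ forall i, S (row i A).

(* The smallest totally geodesic subspace of H^3 containing S is the section of
   the linear span of S; its dimension is one less than that of the span. *)
Definition hdim (R : realType) (S : set 'rV[R]_4) (k : nat) : Prop :=
  has_free S k.+1 /\ ~ has_free S k.+2.

(* A unit spacelike vector u is the outward unit normal of the half-space
   { x | <x, u> <= 0 }, whose boundary plane is { x | <x, u> = 0 }. *)
Definition polyhedron (R : realType) (I : Type) (e : I -> 'rV[R]_4) :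
    set 'rV[R]_4 :=
  [set x | H3 x /\ forall f, lorentz x (e f) <= 0].

Definition face (R : realType) (I : Type) (e : I -> 'rV[R]_4) (f : I) :
    set 'rV[R]_4 :=
  [set x | polyhedron e x /\ lorentz x (e f) = 0].

(* Interior angle between two half-spaces with outward unit normals u and v. *)
Definition dihedral_angle (R : realType) (u v : 'rV[R]_4) : R :=
  acos (- lorentz u v).

(* e is the family of outward unit normals of a compact 3-dimensional convex
   polyhedron in H^3 whose (2-dimensional) faces are labelled, bijectively, by
   I in such a way that two faces share an edge exactly when their labels are
   related by adj.  The conditions e_inj and face_dim exclude repeated and
   redundant half-spaces. *)
Record realizes (R : realType) (I : finType) (adj : rel I)
    (e : I -> 'rV[R]_4) : Prop := Realizes {
  e_unit : forall f, lorentz (e f) (e f) = 1;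
  e_inj : injective e;
  poly_compact : compact (polyhedron e);
  poly_dim : hdim (polyhedron e) 3;
  face_dim : forall f, hdim (face e f) 2;
  face_adj : forall f g, adj f g <-> hdim (face e f `&` face e g) 1 }.

Definition right_angled (R : realType) (I : finType) (adj : rel I)
    (e : I -> 'rV[R]_4) : Prop :=
  forall f g, adj f g -> dihedral_angle (e f) (e g) = pi / 2.

(* Labels of the 2n+2 faces: inl true is the top face, inl false the bottom
   face, inr (true, i) is U_i and inr (false, i) is V_i, with i in Z/n. *)
Definition lobell_face (n : nat) : finType := (bool + bool * 'I_n)%type.

Definition Top (n : nat) : lobell_face n := inl true.
Definition Bottom (n : nat) : lobell_face n := inl false.

(* ordS is the cyclic successor i |-> i + 1 on Z/n.  The numbers of sides of
   the faces are the numbers of neighbours: n for top and bottom, 5 for each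
   U_i and V_i (when n >= 3). *)
Definition lobell_adj (n : nat) : rel (lobell_face n) := fun f g =>
  match f, g with
  | inl _, inl _ => false
  | inl b, inr (c, _) => b == c
  | inr (c, _), inl b => b == c
  | inr (true, i), inr (false, j) => (j == i) || (j == ordS i)
  | inr (false, j), inr (true, i) => (j == i) || (j == ordS i)
  | inr (_, i), inr (_, j) => (j == ordS i) || (i == ordS j)
  end.

(* e describes a right-angled compact realization of the Löbell polyhedron. *)
Definition is_lobell (R : realType) (n : nat)
    (e : lobell_face n -> 'rV[R]_4) : Prop :=
  realizes (@lobell_adj n) e /\ right_angled (@lobell_adj n) e.

Definition lobell_delta (R : realType) (n : nat)
    (e : lobell_face n -> 'rV[R]_4) : R :=
  hset_dist (face e (Top n)) (face e (Bottom n)).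

(* Main.v *)
Require Import Defs.
From mathcomp Require Import all_boot all_order all_algebra.
From mathcomp Require Import all_classical all_reals all_analysis.
From mathcomp Require Import zify ring lra.
Import Order.TTheory GRing.Theory Num.Theory.
Import numFieldNormedType.Exports.
Local Open Scope classical_set_scope.
Local Open Scope ring_scope.

(** Write t, b, u_i, v_i for the outward normals of the top, the bottom, U_i
    and V_i.  The planes of top and bottom are disjoint (top_bottom_lt) and
    cosh delta_n = - <t, b>, the feet of their common perpendicular being in the
    two faces; put S = sinh delta_n.

    The reason is that the n upper pentagons crowd around the common
    perpendicular.  They are all orthogonal to the top plane.  Let c be the unit timelike vector orthogonal to t in the
    span of t and b, which is the foot of the common perpendicular in the top
    plane, and let q_i be the component of u_i in the Euclidean plane orthogonal
    to t and b, so that |q_i|^2 = 1 + <u_i, c>^2 and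
      <u_i, u_j> = q_i . q_j - <u_i, c> <u_j, c>,   <u_i, c> = <u_i, b> / S.
    Two facts hold uniformly in n:
    - <u_i, u_j> <= 0 for i <> j (upper_le0), since the foot of the
      perpendicular from a point of the top face to the plane of U_i falls on
      the edge between top and U_i, as it does in every polygon whose angles are
      right;
    - <u_i, b>^2 <= <t, b>^2 + 1 = S^2 + 2 (bottom_upper_bound), a relation
      between U_i, its neighbours V_i and V_(i+1), the bottom and the top.
    If S is not small, then <u_i, c> is bounded by the second fact, and by the
    first one the unit vectors q_i / |q_i| are at squared distance at least
    S^2 / (S^2 + 1) from each other (upper_directions).  There are n of them in
    a Euclidean plane, so S tends to 0 (S2_small, by pigeonhole_square).

    The signs of the products come from the fact that a causal vector has a
    strict sign on hyperbolic space (causal_orth_eq0, future_causal_lt0), and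
    the identities from expanding vectors in a Lorentz-orthonormal frame made of
    three pairwise orthogonal faces and the common point of their planes
    (frame_lorentz, frame_point). *)

Set Implicit Arguments.
Unset Strict Implicit.

(** * The Lorentz form and causal vectors *)

Lemma lorentzE (R : realType) (x y : 'rV[R]_4) :
  lorentz x y = x 0 1 * y 0 1 + x 0 2 * y 0 2 + x 0 3 * y 0 3 - x 0 0 * y 0 0.
Proof.
rewrite /lorentz !big_ord_recl big_ord0 addr0 !addrA.
by congr (_ * _ + _ * _ + _ * _ - _); congr (_ 0 _); apply/val_inj.
Qed.

Lemma lorentzC (R : realType) (x y : 'rV[R]_4) : lorentz x y = lorentz y x.
Proof. by rewrite !lorentzE; ring. Qed.

Lemma lorentzDl (R : realType) (x y z : 'rV[R]_4) :
  lorentz (x + y) z = lorentz x z + lorentz y z.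
Proof. by rewrite !lorentzE !mxE; ring. Qed.

Lemma lorentzZl (R : realType) (a : R) (x z : 'rV[R]_4) :
  lorentz (a *: x) z = a * lorentz x z.
Proof. by rewrite !lorentzE !mxE; ring. Qed.

Lemma lorentzNl (R : realType) (x z : 'rV[R]_4) :
  lorentz (- x) z = - lorentz x z.
Proof. by rewrite !lorentzE !mxE; ring. Qed.

Lemma lorentzDr (R : realType) (x y z : 'rV[R]_4) :
  lorentz z (x + y) = lorentz z x + lorentz z y.
Proof. by rewrite ![lorentz z _]lorentzC lorentzDl. Qed.

Lemma lorentzZr (R : realType) (a : R) (x z : 'rV[R]_4) :
  lorentz z (a *: x) = a * lorentz z x.
Proof. by rewrite ![lorentz z _]lorentzC lorentzZl. Qed.

Lemma lorentzNr (R : realType) (x z : 'rV[R]_4) :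
  lorentz z (- x) = - lorentz z x.
Proof. by rewrite ![lorentz z _]lorentzC lorentzNl. Qed.

Lemma lorentz0l (R : realType) (x : 'rV[R]_4) : lorentz 0 x = 0.
Proof. by rewrite lorentzE !mxE; ring. Qed.

Definition lorentz_lin (R : realType) :=
  (@lorentzDl R, @lorentzDr R, @lorentzNl R, @lorentzNr R,
   @lorentzZl R, @lorentzZr R).

Lemma cauchy_schwarz3 (R : realType) (a b c x y z : R) :
  (a * x + b * y + c * z) ^+ 2 <=
  (a ^+ 2 + b ^+ 2 + c ^+ 2) * (x ^+ 2 + y ^+ 2 + z ^+ 2).
Proof.
rewrite -subr_ge0.
have -> : (a ^+ 2 + b ^+ 2 + c ^+ 2) * (x ^+ 2 + y ^+ 2 + z ^+ 2) -
    (a * x + b * y + c * z) ^+ 2 =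
    (a * y - b * x) ^+ 2 + (a * z - c * x) ^+ 2 + (b * z - c * y) ^+ 2 by ring.
by rewrite !addr_ge0 ?sqr_ge0.
Qed.

(** Cauchy-Schwarz on the spacelike coordinates, in the form from which the
    sign rules below for causal vectors follow. *)
Lemma H3_causal (R : realType) (x z : 'rV[R]_4) :
  H3 x -> lorentz z z <= 0 ->
  (lorentz x z + x 0 0 * z 0 0) ^+ 2 <=
  (x 0 0 ^+ 2 - 1) * (z 0 0 ^+ 2 + lorentz z z).
Proof.
rewrite /H3 /= !lorentzE => -[hx _] hz.
have := cauchy_schwarz3 (x 0 1) (x 0 2) (x 0 3) (z 0 1) (z 0 2) (z 0 3).
have -> : x 0 1 ^+ 2 + x 0 2 ^+ 2 + x 0 3 ^+ 2 = x 0 0 ^+ 2 - 1 by lra.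
by congr (_ <= _); ring.
Qed.

Lemma H3_time_ge1 (R : realType) (x : 'rV[R]_4) : H3 x -> 0 <= x 0 0 ^+ 2 - 1.
Proof.
rewrite /H3 /= lorentzE => -[hx _].
have -> : x 0 0 ^+ 2 - 1 = x 0 1 ^+ 2 + x 0 2 ^+ 2 + x 0 3 ^+ 2 by lra.
by rewrite !addr_ge0 ?sqr_ge0.
Qed.

Lemma future_causal_lt0 (R : realType) (x z : 'rV[R]_4) :
  H3 x -> lorentz z z <= 0 -> 0 < z 0 0 -> lorentz x z < 0.
Proof.
move=> hx hz z0; have := H3_causal hx hz; have := H3_time_ge1 hx.
case: hx => _ x0 hx1 h; rewrite ltNge; apply/negP => hl.
have : 0 < z 0 0 ^+ 2 by rewrite exprn_gt0.
have : 0 < x 0 0 * z 0 0 by rewrite mulr_gt0.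
have : (x 0 0 ^+ 2 - 1) * (z 0 0 ^+ 2 + lorentz z z) <=
  (x 0 0 ^+ 2 - 1) * z 0 0 ^+ 2 by rewrite ler_wpM2l //; lra.
nra.
Qed.

Lemma causal_future (R : realType) (x z : 'rV[R]_4) :
  H3 x -> lorentz z z <= 0 -> lorentz x z < 0 -> 0 < z 0 0.
Proof.
move=> hx hz hl; rewrite ltNge; apply/negP => z0.
have : 0 <= - z 0 0 by lra.
rewrite le_eqVlt => /orP[/eqP hz0|hz0].
- have := H3_causal hx hz.
  have -> : z 0 0 = 0 by lra.
  have := H3_time_ge1 hx; nra.
- have hz' : lorentz (- z) (- z) <= 0 by rewrite !lorentz_lin; lra.
  have hz0' : 0 < (- z) 0 0 by rewrite mxE.
  by have := future_causal_lt0 hx hz' hz0'; rewrite lorentzNr; lra.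
Qed.

Lemma causal_orth_eq0 (R : realType) (x z : 'rV[R]_4) :
  H3 x -> lorentz z z <= 0 -> lorentz x z = 0 -> z = 0.
Proof.
move=> hx hz hl; have := H3_causal hx hz; have := H3_time_ge1 hx.
rewrite hl add0r => h1 h.
have hz0 : z 0 0 = 0.
  have : (x 0 0 ^+ 2 - 1) * (z 0 0 ^+ 2 + lorentz z z) <=
    (x 0 0 ^+ 2 - 1) * z 0 0 ^+ 2 by rewrite ler_wpM2l //; lra.
  by move=> h2; apply/eqP; rewrite -sqrf_eq0; apply/eqP; nra.
move: hz; rewrite lorentzE hz0 => hz.
have h1' := sqr_ge0 (z 0 1); have h2' := sqr_ge0 (z 0 2).
have h3' := sqr_ge0 (z 0 3).
have z1 : z 0 1 = 0 by apply/eqP; rewrite -sqrf_eq0; apply/eqP; lra.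
have z2 : z 0 2 = 0 by apply/eqP; rewrite -sqrf_eq0; apply/eqP; lra.
have z3 : z 0 3 = 0 by apply/eqP; rewrite -sqrf_eq0; apply/eqP; lra.
apply/rowP => -[[|[|[|[|k]]]] // hk]; rewrite [RHS]mxE.
- by rewrite -hz0; congr (z 0 _); apply/val_inj.
- by rewrite -z1; congr (z 0 _); apply/val_inj.
- by rewrite -z2; congr (z 0 _); apply/val_inj.
- by rewrite -z3; congr (z 0 _); apply/val_inj.
Qed.

Lemma H3_lorentz_leN1 (R : realType) (x y : 'rV[R]_4) :
  H3 x -> H3 y -> lorentz x y <= - 1.
Proof.
move=> hx hy; rewrite leNgt; apply/negP => hl.
have hxy : lorentz (y - x) (y - x) <= 0.
  case: hx => hx _; case: hy => hy _.
  by rewrite !lorentz_lin hx hy (lorentzC y x); lra.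
case: (ltrgtP (y 0 0) (x 0 0)) => h0.
- have h0' : 0 < (x - y) 0 0 by rewrite !mxE subr_gt0.
  have hxy' : lorentz (x - y) (x - y) <= 0.
    by rewrite -opprB lorentzNl lorentzNr opprK.
  have := future_causal_lt0 hy hxy' h0'; case: hx => hx _; case: hy => hy _.
  by rewrite !lorentz_lin hy (lorentzC y x); lra.
- have h0' : 0 < (y - x) 0 0 by rewrite !mxE subr_gt0.
  have := future_causal_lt0 hx hxy h0'; case: hx => hx _.
  by rewrite !lorentz_lin hx; lra.
- have := H3_causal hx hxy; rewrite !mxE h0 subrr mulr0 addr0 expr0n /= add0r.
  have := H3_time_ge1 hx; case: hx => hx x0; case: hy => hy _.
  rewrite !lorentz_lin hx hy (lorentzC y x) => h1 h2.
  nra.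
Qed.

Lemma future_causal_le0 (R : realType) (x z w : 'rV[R]_4) :
  H3 x -> lorentz z z <= 0 -> lorentz w w <= 0 -> lorentz x z < 0 ->
  lorentz x w <= 0 -> lorentz z w <= 0.
Proof.
move=> hx hz hw hxz; rewrite le_eqVlt => /orP[/eqP hxw|hxw].
  by rewrite (causal_orth_eq0 hx hw hxw) lorentzC lorentz0l.
have z0 := causal_future hx hz hxz; have w0 := causal_future hx hw hxw.
rewrite leNgt; apply/negP => h; move: hz hw h; rewrite !lorentzE => hz hw h.
have := cauchy_schwarz3 (z 0 1) (z 0 2) (z 0 3) (w 0 1) (w 0 2) (w 0 3).
apply/negP; rewrite -ltNge.
apply: (@le_lt_trans _ _ (z 0 0 ^+ 2 * w 0 0 ^+ 2)).
  by apply: ler_pM; rewrite ?addr_ge0 ?sqr_ge0 //; lra.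
have zw := mulr_gt0 z0 w0; rewrite -exprMn ltr_pXn2r // ?nnegrE; lra.
Qed.

(** * Orthonormal frames *)

Definition lorentz_frame (R : realType) (e1 e2 e3 p : 'rV[R]_4) : Prop :=
  [/\ [/\ lorentz e1 e1 = 1, lorentz e2 e2 = 1, lorentz e3 e3 = 1 &
          lorentz p p = -1],
      [/\ lorentz e1 e2 = 0, lorentz e1 e3 = 0 & lorentz e2 e3 = 0] &
      [/\ lorentz e1 p = 0, lorentz e2 p = 0 & lorentz e3 p = 0]].

Definition minkowski (R : realType) : 'M[R]_4 :=
  diag_mx (\row_i (if i == 0 then -1 else 1)).

Lemma lorentz_mx (R : realType) (x y : 'rV[R]_4) :
  lorentz x y = (x *m minkowski R *m y^T) 0 0.
Proof.
rewrite lorentzE !mxE !big_ord_recl big_ord0 !mul_mx_diag !mxE /= addr0.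
rewrite mulr1 mulrN1 mulNr addrC !addrA; congr (_ + _ + _ + _).
- by congr (_ * _); congr (_ 0 _); apply/val_inj.
- by rewrite mulr1; congr (_ * _); congr (_ 0 _); apply/val_inj.
- by rewrite mulr1; congr (_ * _); congr (_ 0 _); apply/val_inj.
Qed.

(** The rows of a frame form an invertible matrix M, since M J M^T squares to
    the identity; a vector orthogonal to all of them is therefore zero. *)
Lemma frame_orth_eq0 (R : realType) (e1 e2 e3 p x : 'rV[R]_4) :
  lorentz_frame e1 e2 e3 p -> lorentz x e1 = 0 -> lorentz x e2 = 0 ->
  lorentz x e3 = 0 -> lorentz x p = 0 -> x = 0.
Proof.
move=> [[h11 h22 h33 hpp] [h12 h13 h23] [h1p h2p h3p]] h1 h2 h3 hp.
pose f (i : 'I_4) := nth 0 [:: e1; e2; e3; p] i.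
pose M : 'M[R]_4 := \matrix_i f i.
pose D : 'M[R]_4 := M *m minkowski R *m M^T.
have DE i j : D i j = lorentz (f i) (f j).
  by rewrite lorentz_mx !mxE; apply: eq_bigr => k _; rewrite !mul_mx_diag !mxE.
have hD : D = diag_mx (\row_i (if i == 3 then -1 else 1)).
  apply/matrixP => -[[|[|[|[|i]]]] // hi] [[|[|[|[|j]]]] // hj];
  by rewrite DE !mxE /f /= ?mulr1n ?mulr0n // lorentzC.
have hDD : D *m D = 1%:M.
  rewrite {1}hD hD mul_diag_mx; apply/matrixP => i j; rewrite !mxE.
  case: (i == j); rewrite ?mulr1n ?mulr0n ?mulr0 //.
  by case: (i == 3); rewrite ?mulrNN mulr1.
have hx : x *m (minkowski R *m M^T) = 0.
  have hx i : (x *m (minkowski R *m M^T)) 0 i = lorentz x (f i).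
    by rewrite lorentz_mx mulmxA !mxE; apply: eq_bigr => k _; rewrite !mxE.
  by apply/rowP => -[[|[|[|[|i]]]] // hi]; rewrite hx mxE.
have uT : minkowski R *m M^T \in unitmx.
  have : D \in unitmx by case: (mulmx1_unit hDD).
  by rewrite /D -mulmxA unitmx_mul => /andP[].
by rewrite -[x](mulmxK uT) hx mul0mx.
Qed.

Lemma frame_expand (R : realType) (e1 e2 e3 p x : 'rV[R]_4) :
  lorentz_frame e1 e2 e3 p ->
  x = lorentz x e1 *: e1 + lorentz x e2 *: e2 + lorentz x e3 *: e3
      - lorentz x p *: p.
Proof.
move=> hf; apply/eqP; rewrite -subr_eq0; apply/eqP.
have [[h11 h22 h33 hpp] [h12 h13 h23] [h1p h2p h3p]] := hf.
apply: (frame_orth_eq0 hf); rewrite !lorentz_lin ?(lorentzC e2 e1)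
  ?(lorentzC e3 e1) ?(lorentzC e3 e2) ?(lorentzC p) ?h11 ?h22 ?h33 ?hpp ?h12
  ?h13 ?h23 ?h1p ?h2p ?h3p; ring.
Qed.

Lemma frame_lorentz (R : realType) (e1 e2 e3 p x y : 'rV[R]_4) :
  lorentz_frame e1 e2 e3 p ->
  lorentz x y = lorentz x e1 * lorentz y e1 + lorentz x e2 * lorentz y e2 +
    lorentz x e3 * lorentz y e3 - lorentz x p * lorentz y p.
Proof.
move=> hf; rewrite {1}(frame_expand y hf) !lorentz_lin; ring.
Qed.

Lemma frame_third_unique (R : realType) (e1 e2 e3 p w : 'rV[R]_4) :
  lorentz_frame e1 e2 e3 p -> lorentz w e1 = 0 -> lorentz w e2 = 0 ->
  lorentz w p = 0 -> lorentz w w = 1 -> w = e3 \/ w = - e3.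
Proof.
move=> fp h1 h2 hp hw.
have wE := frame_expand w fp.
rewrite h1 h2 hp !scale0r subr0 !add0r in wE.
have := frame_lorentz w w fp; rewrite h1 h2 hp hw => h.
have /eqP : lorentz w e3 ^+ 2 = 1 by lra.
rewrite sqrf_eq1 => /orP[] /eqP h3; rewrite wE h3.
  by left; rewrite scale1r.
by right; rewrite scaleN1r.
Qed.

Lemma H3_normalize (R : realType) (x y : 'rV[R]_4) :
  H3 x -> lorentz y y < 0 -> lorentz x y < 0 ->
  exists2 k, 0 < k & H3 (k *: y).
Proof.
move=> hx hy hxy; exists (Num.sqrt (- lorentz y y))^-1.
  by rewrite invr_gt0 sqrtr_gt0 oppr_gt0.
split; last first.
  rewrite mxE mulr_gt0 ?invr_gt0 ?sqrtr_gt0 ?oppr_gt0 //.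
  exact: (causal_future hx (ltW hy) hxy).
rewrite !lorentz_lin mulrA -invfM -expr2 sqr_sqrtr ?oppr_ge0 ?ltW //.
by field; rewrite lt_eqF.
Qed.

(** An orthonormal triple of spacelike vectors, i.e. three pairwise orthogonal
    planes, has a common point: the projection of any point of H^3. *)
Lemma frame_point (R : realType) (e1 e2 e3 x : 'rV[R]_4) :
  lorentz e1 e1 = 1 -> lorentz e2 e2 = 1 -> lorentz e3 e3 = 1 ->
  lorentz e1 e2 = 0 -> lorentz e1 e3 = 0 -> lorentz e2 e3 = 0 -> H3 x ->
  exists p, exists2 k, 0 < k & [/\ H3 p, lorentz_frame e1 e2 e3 p &
    p = k *: (x - lorentz x e1 *: e1 - lorentz x e2 *: e2
              - lorentz x e3 *: e3)].
Proof.
move=> h11 h22 h33 h12 h13 h23 hx.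
pose y := x - lorentz x e1 *: e1 - lorentz x e2 *: e2 - lorentz x e3 *: e3.
have hyx : lorentz x y = lorentz y y.
  rewrite /y !lorentz_lin !(lorentzC _ x) ?(lorentzC e2 e1)
    ?(lorentzC e3 e1) ?(lorentzC e3 e2) h11 h22 h33 h12 h13 h23; ring.
have hy : lorentz x y < 0.
  case: hx => hx _; rewrite /y !lorentz_lin hx.
  have := sqr_ge0 (lorentz x e1); have := sqr_ge0 (lorentz x e2).
  by have := sqr_ge0 (lorentz x e3); lra.
have [||k k0 hk] := @H3_normalize _ x y hx; rewrite -?hyx //.
exists (k *: y), k => //; split=> //.
have o1 : lorentz e1 (k *: y) = 0.
  by rewrite /y !lorentz_lin (lorentzC e1 x) h11 h12 h13; ring.
have o2 : lorentz e2 (k *: y) = 0.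
  by rewrite /y !lorentz_lin (lorentzC e2 x) (lorentzC e2 e1) h22 h12 h23; ring.
have o3 : lorentz e3 (k *: y) = 0.
  rewrite /y !lorentz_lin (lorentzC e3 x) (lorentzC e3 e1) (lorentzC e3 e2).
  by rewrite h33 h13 h23; ring.
by case: hk => hk _.
Qed.

(** Gram-Schmidt in the plane orthogonal to t and c, which is positive definite,
    applied to the projections of u and w; these are independent because their
    Gram matrix is the identity plus a positive semidefinite matrix. *)
Lemma frame_complete (R : realType) (t c u w : 'rV[R]_4) :
  lorentz t t = 1 -> lorentz c c = -1 -> lorentz t c = 0 ->
  lorentz u u = 1 -> lorentz w w = 1 -> lorentz u w = 0 ->
  lorentz t u = 0 -> lorentz t w = 0 ->
  exists f g, lorentz_frame t f g c.
Proof.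
move=> tt cc tc uu ww uw tu tw.
pose y := lorentz u c; pose x := lorentz w c.
have y1 : 0 < 1 + y ^+ 2 by have := sqr_ge0 y; lra.
have [s s0 ss] : exists2 s, s != 0 & s ^+ 2 = 1 + y ^+ 2.
  exists (Num.sqrt (1 + y ^+ 2)); last by rewrite sqr_sqrtr ?ltW.
  by rewrite gt_eqF ?sqrtr_gt0.
pose f := s^-1 *: (u + y *: c).
have tf : lorentz t f = 0 by rewrite /f !lorentz_lin tu tc; ring.
have fc : lorentz f c = 0 by rewrite /f !lorentz_lin cc -/y; ring.
have ff : lorentz f f = 1.
  rewrite /f !lorentz_lin uu cc (lorentzC c u) -/y.
  transitivity (s ^- 2 * (1 + y ^+ 2)); first by rewrite -exprVn; ring.
  by rewrite -ss mulVf // expf_neq0.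
have wf : lorentz w f ^+ 2 = (x * y) ^+ 2 / (1 + y ^+ 2).
  rewrite /f !lorentz_lin (lorentzC w u) uw -/x add0r exprMn exprVn ss mulrC.
  by rewrite [y * x]mulrC.
clearbody f; pose h := w + x *: c - lorentz w f *: f.
pose N := 1 + x ^+ 2 - lorentz w f ^+ 2.
have th : lorentz t h = 0 by rewrite /h !lorentz_lin tw tc tf; ring.
have hc : lorentz h c = 0 by rewrite /h !lorentz_lin cc fc -/x; ring.
have fh : lorentz f h = 0.
  by rewrite /h !lorentz_lin ff fc (lorentzC f w); ring.
have hh : lorentz h h = N.
  rewrite /h !lorentz_lin ff cc ww (lorentzC c w) (lorentzC c f) (lorentzC f w).
  by rewrite fc -/x /N; ring.
have N0 : 0 < N.
  rewrite /N wf subr_gt0 ltr_pdivrMr //.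
  by have := sqr_ge0 x; have := sqr_ge0 y; nra.
clearbody h; exists f, ((Num.sqrt N)^-1 *: h); split; split;
  rewrite ?lorentz_lin ?ff //.
- by rewrite hh mulrA -invfM -expr2 sqr_sqrtr ?ltW // mulVf // gt_eqF.
- by rewrite th mulr0.
- by rewrite fh mulr0.
- by rewrite hc mulr0.
Qed.

(** * Right-angled polyhedra *)

Lemma acos_eq_pihalf (R : realType) (x : R) : acos x = pi / 2 -> x = 0.
Proof.
move=> hx; have pi0 : 0 < pi / 2 :> R by rewrite divr_gt0 ?pi_gt0.
have [he|he] := pselect (exists y, 0 <= y <= pi /\ cos y = x).
  have x1 : -1 <= x <= 1 by case: he => y [_ <-]; rewrite cos_geN1 cos_le1.
  by have [_ <-] := acos_def x1; rewrite hx cos_pihalf.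
move: hx; rewrite unlock xgetPN => [h|y hy]; first by rewrite -h ltxx in pi0.
by apply: he; exists y.
Qed.

Lemma right_angled_orth (R : realType) (I : finType) (adj : rel I)
    (e : I -> 'rV[R]_4) f g :
  right_angled adj e -> adj f g -> lorentz (e f) (e g) = 0.
Proof. by move=> h /h /acos_eq_pihalf /eqP; rewrite oppr_eq0 => /eqP. Qed.

Lemma hdim_point (R : realType) (S : set 'rV[R]_4) k :
  hdim S k -> exists x, S x.
Proof. by move=> [[A [_ hA]] _]; exists (row ord0 A). Qed.

(** If the half-spaces of two distinct faces were nested, which is what a
    product at least 1 of their normals means, the difference of the normals
    would be a causal vector, and so have a strict sign on H^3; the two faces
    give it opposite signs. *)
Lemma normals_lt1 (R : realType) (I : finType) (adj : rel I)
    (e : I -> 'rV[R]_4) f g :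
  realizes adj e -> f <> g -> lorentz (e f) (e g) < 1.
Proof.
move=> he fg; rewrite ltNge; apply/negP => h.
have [x [[hx px] xg]] := hdim_point (face_dim he g).
have [y [[hy py] yf]] := hdim_point (face_dim he f).
have hd : lorentz (e f - e g) (e f - e g) <= 0.
  by rewrite !lorentz_lin !(e_unit he) (lorentzC (e g)); lra.
have dx : lorentz x (e f - e g) <= 0 by rewrite !lorentz_lin xg; have := px f; lra.
have dy : 0 <= lorentz y (e f - e g).
  by rewrite !lorentz_lin yf; have := py g; lra.
have d0 : e f - e g <> 0.
  by move/eqP; rewrite subr_eq0 => /eqP /(e_inj he).
move: dx; rewrite le_eqVlt => /orP[/eqP dx|dx].
  exact/d0/(causal_orth_eq0 hx hd dx).
have := future_causal_lt0 hy hd (causal_future hx hd dx); lra.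
Qed.

(** Two opposite normals would confine the polyhedron to a plane. *)
Lemma normals_neq_opp (R : realType) (I : finType) (adj : rel I)
    (e : I -> 'rV[R]_4) f g : realizes adj e -> e f <> - e g.
Proof.
move=> he hfg; have [[A [fA hA]] _] := poly_dim he.
have hx x : polyhedron e x -> lorentz x (e f) = 0.
  move=> [_ px]; have := px f; have := px g; rewrite hfg lorentzNr; lra.
have uA : A \in unitmx by rewrite -row_free_unit.
have : A *m (minkowski R *m (e f)^T) = 0.
  apply/colP => i; rewrite [RHS]mxE -(hx _ (hA i)) lorentz_mx mulmxA !mxE.
  by apply: eq_bigr => k _; rewrite !mul_mx_diag !mxE.
move/(congr1 (mulmx (invmx A))); rewrite mulKmx // mulmx0 => h0.
have := e_unit he f; rewrite lorentz_mx -mulmxA h0 mulmx0 mxE => /eqP.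
by rewrite eq_sym oner_eq0.
Qed.

Lemma adj_edge_point (R : realType) (I : finType) (adj : rel I)
    (e : I -> 'rV[R]_4) f g :
  realizes adj e -> adj f g ->
  exists x, [/\ polyhedron e x, lorentz x (e f) = 0 & lorentz x (e g) = 0].
Proof.
by move=> he /(face_adj he)/hdim_point[x [[px xf] [_ xg]]]; exists x.
Qed.

(** The normals e f and e g lie in the Lorentzian plane orthogonal to the
    normals of two common neighbours, where two unit spacelike vectors have
    product at least 1 in absolute value. *)
Lemma common_neighbours_leN1 (R : realType) (I : finType) (adj : rel I)
    (e : I -> 'rV[R]_4) f g h1 h2 :
  realizes adj e -> right_angled adj e -> f <> g ->
  adj f h1 -> adj f h2 -> adj h1 h2 -> adj g h1 -> adj g h2 ->
  lorentz (e f) (e g) <= -1.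
Proof.
move=> he ra fg /(right_angled_orth ra) f1 /(right_angled_orth ra) f2.
move=> /(right_angled_orth ra) h12 /(right_angled_orth ra) g1.
move=> /(right_angled_orth ra) g2.
have [x [hx _]] := hdim_point (poly_dim he).
have := frame_point (e_unit he f) (e_unit he h1) (e_unit he h2) f1 f2 h12 hx.
move=> [p [_ _ [_ hp _]]].
have := frame_lorentz (e g) (e g) hp; rewrite (e_unit he) g1 g2.
rewrite (lorentzC (e g)) => h.
have := normals_lt1 he fg; have := sqr_ge0 (lorentz (e g) p); nra.
Qed.

(** Projecting a point of the edge between h1 and h2 to the plane of f keeps
    it inside the polyhedron: subtracting the nonpositive multiple <x, e f> of
    e f does not increase the products with the other normals. *)
Lemma vertex_exists (R : realType) (I : finType) (adj : rel I)
    (e : I -> 'rV[R]_4) f h1 h2 :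
  realizes adj e -> right_angled adj e ->
  (forall g, g <> f -> lorentz (e f) (e g) <= 0) ->
  adj f h1 -> adj f h2 -> adj h1 h2 ->
  exists2 p, polyhedron e p & lorentz_frame (e f) (e h1) (e h2) p.
Proof.
move=> he ra hf a1 a2 a12.
have [x [[hx px] x1 x2]] := adj_edge_point he a12.
have f1 := right_angled_orth ra a1; have f2 := right_angled_orth ra a2.
have h12 := right_angled_orth ra a12.
have := frame_point (e_unit he f) (e_unit he h1) (e_unit he h2) f1 f2 h12 hx.
move=> [p [k k0 [Hp hp pE]]]; exists p => //; split=> // g.
have [->|/eqP gf] := eqVneq g f.
  by case: hp => _ _ [h _ _]; rewrite lorentzC h.
rewrite pE x1 x2 !lorentz_lin !mul0r !subr0 pmulr_rle0 // subr_le0.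
by apply: (le_trans (px g)); rewrite mulr_le0 ?px ?hf.
Qed.

(** Such a z is an ideal point of the polyhedron: the normalizations of
    x + s z, for x in the polyhedron, stay in it and their time coordinate
    grows like the square root of s. *)
Lemma no_ideal_point (R : realType) (I : finType) (adj : rel I)
    (e : I -> 'rV[R]_4) (z : 'rV[R]_4) :
  realizes adj e -> lorentz z z = 0 -> 0 < z 0 0 ->
  ~ (forall f, lorentz z (e f) <= 0).
Proof.
move=> he zz z0 hz.
have [x [hx px]] := hdim_point (poly_dim he).
have xz : lorentz x z < 0 by apply: future_causal_lt0 => //; rewrite zz.
have [M hM] : exists M, forall y, polyhedron e y -> `|y 0 0| <= M.
  have /compact_bounded [M [_ hM]] := poly_compact he.
  exists (M + 1) => y hy; apply: le_trans (hM (M + 1) _ y hy); last by lra.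
  rewrite [leRHS]mx_normrE.
  by apply: (le_bigmax _ (fun ij => `|y ij.1 ij.2|) (0, 0)).
pose m := - lorentz x z.
have hb s : 0 <= s -> (x 0 0 + s * z 0 0) ^+ 2 <= M ^+ 2 * (1 + 2 * s * m).
  move=> s0; have [xx x0] := hx.
  have yy : lorentz (x + s *: z) (x + s *: z) = - (1 + 2 * s * m).
    by rewrite !lorentz_lin xx zz (lorentzC z) /m; ring.
  have sm : 0 <= s * m by rewrite mulr_ge0 // /m; lra.
  have [||k k0 hk] := @H3_normalize _ x (x + s *: z) hx.
  - by rewrite yy; lra.
  - by rewrite !lorentz_lin xx; move: sm; rewrite /m; lra.
  have hy : polyhedron e (k *: (x + s *: z)).
    split=> // f; rewrite !lorentz_lin pmulr_rle0 //.
    by have := px f; have := mulr_ge0_le0 s0 (hz f); lra.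
  have := hM _ hy; rewrite !mxE.
  have [] := hk; rewrite !lorentzZl !lorentzZr yy => hk1 _.
  rewrite normrM gtr0_norm // => h.
  have k2 : k ^+ 2 * (1 + 2 * s * m) = 1 by rewrite expr2 -mulrA; lra.
  have h2 : k ^+ 2 * (x 0 0 + s * z 0 0) ^+ 2 <= M ^+ 2.
    rewrite -[X in k ^+ 2 * X]real_normK ?num_real // -exprMn ler_pXn2r // nnegrE.
      by rewrite mulr_ge0 // ltW.
    by apply: le_trans h; rewrite mulr_ge0 // ltW.
  have m1 : 0 <= 1 + 2 * s * m by lra.
  by have := ler_wpM2r m1 h2; rewrite mulrAC k2 mul1r.
pose s := 1 + (2 * m + 1) * M ^+ 2 / z 0 0 ^+ 2.
have m0 : 0 < m by rewrite /m oppr_gt0.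
have z2 : 0 < z 0 0 ^+ 2 by rewrite exprn_gt0.
have M0 := sqr_ge0 M.
have s1 : 1 <= s by rewrite lerDl; apply: divr_ge0 (ltW z2); apply: mulr_ge0; lra.
have sz : s * z 0 0 ^+ 2 = z 0 0 ^+ 2 + (2 * m + 1) * M ^+ 2.
  by rewrite /s; field; rewrite gt_eqF.
have := hb s (le_trans ler01 s1).
have [_ x0] := hx.
have h1 : s * (s * z 0 0 ^+ 2) <= (x 0 0 + s * z 0 0) ^+ 2.
  have : 0 <= x 0 0 * (s * z 0 0) by rewrite !mulr_ge0 ?ltW //; lra.
  by have := sqr_ge0 (x 0 0); lra.
move: h1; rewrite sz => h1 h2.
have h3 : 0 < s * z 0 0 ^+ 2 by rewrite mulr_gt0 //; lra.
have h4 : 0 <= (s - 1) * M ^+ 2 by rewrite mulr_ge0 //; lra.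
by nra.
Qed.

(** For disjoint planes of two faces, whose normals have product at most 0 with
    all the others, the foot of the common perpendicular lies in the face. *)
Lemma common_perpendicular_foot (R : realType) (I : finType) (adj : rel I)
    (e : I -> 'rV[R]_4) f g (C := lorentz (e f) (e g)) :
  realizes adj e -> C < -1 ->
  (forall h, h <> f -> lorentz (e f) (e h) <= 0) ->
  (forall h, h <> g -> lorentz (e g) (e h) <= 0) ->
  exists2 k, 0 < k & face e f (k *: (e g - C *: e f)) /\
                     k ^+ 2 * (C ^+ 2 - 1) = 1.
Proof.
move=> he C1 hf hg; have [x [hx px]] := hdim_point (poly_dim he).
have C2 : 0 < C ^+ 2 - 1 by nra.
pose y := e g - C *: e f.
have yy : lorentz y y = - (C ^+ 2 - 1).
  by rewrite /y !lorentz_lin !(e_unit he) (lorentzC (e g)) -/C; ring.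
have yf : lorentz y (e f) = 0.
  by rewrite /y !lorentz_lin (e_unit he) (lorentzC (e g)) -/C; ring.
have xy : lorentz x y < 0.
  rewrite lt_neqAle; apply/andP; split.
    have yy0 : lorentz y y <= 0 by lra.
    apply/eqP => /(causal_orth_eq0 hx yy0) y0; move: yy.
    by rewrite y0 lorentz0l => yy; lra.
  by rewrite /y !lorentz_lin; have := px f; have := px g; nra.
have ye h : lorentz y (e h) <= 0.
  have [->|/eqP nf] := eqVneq h f; first by rewrite yf.
  have [->|/eqP ng] := eqVneq h g.
    by rewrite /y !lorentz_lin (e_unit he) -/C; lra.
  by rewrite /y !lorentz_lin; have := hf h nf; have := hg h ng; nra.
rewrite -/y; clearbody y.
have [|k k0 hk] := H3_normalize hx _ xy; first by rewrite yy; lra.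
exists k => //; split; last first.
  by case: hk => + _; rewrite !lorentz_lin yy => hk; lra.
split; last by rewrite lorentzZl yf mulr0.
by split=> // h; rewrite lorentzZl pmulr_rle0.
Qed.

(** * Points in a square, and the function arcosh *)

(** Cut the square [-1, 1]^2 into cells of side 1 / m.  There are 2m + 1 columns,
    not 2m, because the value 1 gets a column of its own. *)
Lemma pigeonhole_square (R : realType) (m n : nat) (a b : 'I_n -> R) :
  (0 < m)%N -> (m.*2.+1 ^ 2 < n)%N ->
  (forall i, `|a i| <= 1) -> (forall i, `|b i| <= 1) ->
  exists i j, [/\ i != j, (a i - a j) ^+ 2 <= m%:R ^- 2 &
                  (b i - b j) ^+ 2 <= m%:R ^- 2].
Proof.
move=> m0 hn ha hb.
have mR : 0 < m%:R :> R by rewrite ltr0n.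
pose cell (x : R) : 'I_m.*2.+1 := inord (Num.truncn ((x + 1) * m%:R)).
have cellP x y : `|x| <= 1 -> `|y| <= 1 -> cell x = cell y ->
    (x - y) ^+ 2 <= m%:R ^- 2.
  have bound (w : R) : `|w| <= 1 ->
      (0 <= (w + 1) * m%:R)%R /\ (Num.truncn ((w + 1) * m%:R) < m.*2.+1)%N.
    rewrite ler_norml => /andP[w1 w2]; have w0 : 0 <= (w + 1) * m%:R.
      by apply: mulr_ge0 (ltW mR); lra.
    split=> //; rewrite ltnS truncn_le_nat.
    rewrite -addn1 natrD -muln2 natrM; nra.
  move=> /bound[x0 xm] /bound[y0 ym] /(congr1 val) /=; rewrite !inordK // => h.
  have := truncn_itv x0; have := truncn_itv y0; rewrite h -natr1.
  move=> /andP[h1 h2] /andP[h3 h4].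
  have h5 : `|(x - y) * m%:R| <= 1.
    by rewrite ler_norml mulrBl; apply/andP; split; lra.
  rewrite -[X in X <= _](mulfK (expf_neq0 2 (lt0r_neq0 mR))) -exprMn.
  rewrite ler_pdivrMr ?exprn_gt0 // mulVf ?expf_neq0 ?lt0r_neq0 //.
  by rewrite -real_normK ?num_real // exprn_ile1.
pose F i := (cell (a i), cell (b i)).
have : ~~ injectiveb F.
  apply/negP => /injectiveP /leq_card; rewrite card_prod !card_ord => h.
  by move: hn; rewrite ltnNge -mulnn h.
move=> /injectivePn[i [j ij [h1 h2]]].
by exists i, j; split=> //; apply: cellP.
Qed.

Lemma arcosh_ge0 (R : realType) (x : R) : 1 <= x -> 0 <= arcosh x.
Proof. by move=> x1; rewrite ln_ge0 // (le_trans x1) // lerDl sqrtr_ge0. Qed.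

Lemma arcosh_le (R : realType) (x : R) :
  1 <= x -> arcosh x <= 2 * Num.sqrt (x ^+ 2 - 1).
Proof.
move=> x1; rewrite /arcosh; set s := Num.sqrt _.
have s0 : 0 <= s by rewrite sqrtr_ge0.
have s2 : s ^+ 2 = x ^+ 2 - 1 by rewrite sqr_sqrtr //; nra.
have xs : x <= 1 + s by nra.
rewrite -[x + s](subrKC 1); apply: le_trans (le_ln1Dx _) _; lra.
Qed.

(** * Normals of the Löbell polyhedron *)

Definition Upper n (i : 'I_n) : lobell_face n := inr (true, i).
Definition Lower n (i : 'I_n) : lobell_face n := inr (false, i).

Lemma val_ordS n (i : 'I_n) :
  nat_of_ord (ordS i) = if i.+1 == n then 0%N else i.+1.
Proof.
case: eqP => [/= ->|/eqP h] /=; first exact: modnn.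
by rewrite modn_small // ltn_neqAle h ltn_ord.
Qed.

Lemma ordSS_neq n (i : 'I_n) : (2 < n)%N -> ordS (ordS i) != i.
Proof.
move=> n3; apply/eqP => /(congr1 (@nat_of_ord n)); rewrite val_ordS val_ordS.
have := ltn_ord i; case: (i.+1 =P n) => h1; case: eqP => h2; lia.
Qed.

Section Lobell.
Variables (R : realType) (n : nat) (e : lobell_face n -> 'rV[R]_4).
Hypotheses (n3 : (2 < n)%N) (he : is_lobell e).

Let t := e (Top n).
Let b := e (Bottom n).
Let u i := e (Upper i).
Let v i := e (Lower i).

Let hre : realizes (@lobell_adj n) e := proj1 he.
Let hra : right_angled (@lobell_adj n) e := proj2 he.

Lemma lobell_adjE (i : 'I_n) :
  [/\ lobell_adj (Top n) (Upper i), lobell_adj (Bottom n) (Lower i),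
      lobell_adj (Upper i) (Upper (ordS i)) &
      lobell_adj (Lower i) (Lower (ordS i))] /\
  [/\ lobell_adj (Upper i) (Lower i), lobell_adj (Upper i) (Lower (ordS i)),
      lobell_adj (Lower i) (Upper i) & lobell_adj (Lower (ordS i)) (Upper i)].
Proof. by rewrite /= !eqxx ?orbT. Qed.

Lemma top_upper i : lorentz t (u i) = 0.
Proof. by apply: (right_angled_orth hra); case: (lobell_adjE i) => -[]. Qed.

Lemma bottom_lower i : lorentz b (v i) = 0.
Proof. by apply: (right_angled_orth hra); case: (lobell_adjE i) => -[]. Qed.

Lemma upper_upper i : lorentz (u i) (u (ordS i)) = 0.
Proof. by apply: (right_angled_orth hra); case: (lobell_adjE i) => -[]. Qed.

Lemma lower_lower i : lorentz (v i) (v (ordS i)) = 0.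
Proof. by apply: (right_angled_orth hra); case: (lobell_adjE i) => -[]. Qed.

Lemma upper_lower i : lorentz (u i) (v i) = 0.
Proof. by apply: (right_angled_orth hra); case: (lobell_adjE i) => _ []. Qed.

Lemma upper_lowerS i : lorentz (u i) (v (ordS i)) = 0.
Proof. by apply: (right_angled_orth hra); case: (lobell_adjE i) => _ []. Qed.

Lemma top_lower i : lorentz t (v i) <= -1.
Proof.
have [[a1 _ a3 _] [_ _ _ a4]] := lobell_adjE (ord_pred i).
have [[a2 _ _ _] [_ _ a5 _]] := lobell_adjE i.
rewrite ord_predK in a3 a4.
exact: (common_neighbours_leN1 hre hra _ a1 a2 a3 a4 a5).
Qed.

Lemma bottom_upper i : lorentz b (u i) <= -1.
Proof.
have [[_ a1 _ a2] [a3 a4 _ _]] := lobell_adjE i.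
have [[_ a5 _ _] _] := lobell_adjE (ordS i).
exact: (common_neighbours_leN1 hre hra _ a1 a5 a2 a3 a4).
Qed.

Let unit f : lorentz (e f) (e f) = 1. Proof. exact: (e_unit hre). Qed.

Let i0 : 'I_n := Ordinal (ltn_trans (ltnW (isT : (1 < 2)%N)) n3).

(** Otherwise the planes of top and bottom share a point at infinity z.  It is
    a common ideal point of all half-spaces: the normals t + v_i and b + u_i
    are causal and negative on the polyhedron, hence at z too, where t and b
    vanish. *)
Lemma top_bottom_lt : lorentz t b < -1.
Proof.
rewrite ltNge; apply/negP => htb.
have htb1 : lorentz t b < 1 by exact: (normals_lt1 hre).
have [x [hx px]] := hdim_point (poly_dim hre).
have := frame_point (unit (Top n)) (unit (Upper i0)) (unit (Upper (ordS i0)))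
  (top_upper i0) (top_upper _) (upper_upper i0) hx.
move=> [p [_ _ [hp fp _]]].
have := frame_lorentz b b fp; rewrite unit -/t -/(u i0) -/(u (ordS i0)).
rewrite (lorentzC b t).
have := bottom_upper i0; have := bottom_upper (ordS i0).
set b1 := lorentz b (u i0); set b2 := lorentz b _; set g := lorentz b p.
move=> hb2 hb1 hbb.
pose N := b1 ^+ 2 + b2 ^+ 2.
have N0 : 0 < N by rewrite /N; nra.
have gN : 0 <= N - g ^+ 2 by rewrite /N; nra.
pose D := Num.sqrt (N - g ^+ 2).
have D2 : D ^+ 2 = N - g ^+ 2 by rewrite sqr_sqrtr.
(* A solution of b1 z1 + b2 z2 = - g, z1^2 + z2^2 = 1. *)
pose z1 := (- g * b1 - D * b2) / N; pose z2 := (- g * b2 + D * b1) / N.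
have hz12 : z1 ^+ 2 + z2 ^+ 2 = 1.
  rewrite /z1 /z2 !expr_div_n -mulrDl.
  have -> : (- g * b1 - D * b2) ^+ 2 + (- g * b2 + D * b1) ^+ 2 = N ^+ 2.
    by rewrite [RHS]expr2 -[X in X * N](subrK (g ^+ 2)) -D2 /N; ring.
  by rewrite divff // expf_neq0 // gt_eqF.
have hzb : z1 * b1 + z2 * b2 = - g.
  by rewrite /z1 /z2 /N; field; rewrite gt_eqF.
have [[_ _ _ pp] _ [tp up up']] := fp.
pose z := p + z1 *: u i0 + z2 *: u (ordS i0).
have zz : lorentz z z = 0.
  rewrite /z !lorentz_lin (lorentzC p) (lorentzC p) up up' pp !unit.
  by rewrite (lorentzC (u (ordS i0))) upper_upper; lra.
have zt : lorentz z t = 0.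
  by rewrite /z !lorentz_lin !(lorentzC _ t) tp !top_upper; ring.
have zb : lorentz z b = 0.
  by rewrite /z !lorentz_lin !(lorentzC _ b) -/g -/b1 -/b2; lra.
have pz : lorentz p z < 0.
  by rewrite /z !lorentz_lin pp !(lorentzC p) up up'; lra.
have z0 : 0 < z 0 0 by apply: causal_future pz => //; rewrite zz.
apply: (no_ideal_point hre zz z0) => f.
have xz : lorentz x z < 0 by apply: future_causal_lt0; rewrite ?zz.
have le0 w : lorentz w w <= 0 -> lorentz x w <= 0 -> lorentz z w <= 0.
  by move=> hw; apply: (future_causal_le0 hx); rewrite ?zz.
case: f => [[]|[[] i]]; rewrite -/(Top n) -/(Bottom n) -/t -/b ?zt ?zb //.
- have -> : lorentz z (e (inr (true, i))) = lorentz z (b + u i).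
    by rewrite lorentzDr zb add0r.
  apply: le0; rewrite !lorentz_lin ?(lorentzC (u i) b) ?unit.
    by have := bottom_upper i; lra.
  by have := px (Bottom n); have := px (Upper i); rewrite -/(u i) -/b; lra.
- have -> : lorentz z (e (inr (false, i))) = lorentz z (t + v i).
    by rewrite lorentzDr zt add0r.
  apply: le0; rewrite !lorentz_lin ?(lorentzC (v i) t) ?unit.
    by have := top_lower i; lra.
  by have := px (Top n); have := px (Lower i); rewrite -/(v i) -/t; lra.
Qed.

Lemma top_le0 g : g <> Top n -> lorentz t (e g) <= 0.
Proof.
case: g => [[]|[[] i]] // _.
- by have := top_bottom_lt; rewrite -/(Bottom n) -/b; lra.
- by have := top_upper i; rewrite -/(Upper i) /u => ->.
- by have := top_lower i; rewrite -/(Lower i) /v; lra.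
Qed.

Lemma upper_vertex i :
  exists2 p, polyhedron e p & lorentz_frame t (u i) (u (ordS i)) p.
Proof.
have [[a1 _ a3 _] _] := lobell_adjE i.
have [[a2 _ _ _] _] := lobell_adjE (ordS i).
exact: (vertex_exists hre hra top_le0).
Qed.

Let upper_neq j : u (ordS (ordS j)) <> u j /\ u (ordS (ordS j)) <> - u j.
Proof.
split; last exact: (normals_neq_opp hre).
by move/(e_inj hre) => [] /eqP; rewrite (negbTE (ordSS_neq j n3)).
Qed.

(** A plane through the vertex of t, U_j and U_(j+1) orthogonal to t and
    U_(j+1) is that of U_j. *)
Lemma upper_next_neq0 j p :
  lorentz_frame t (u j) (u (ordS j)) p -> lorentz (u (ordS (ordS j))) p != 0.
Proof.
move=> fp; apply/eqP => h; have [ne neN] := upper_neq j.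
have fp' : lorentz_frame t (u (ordS j)) (u j) p.
  by case: fp => -[? ? ? ?] [? ? ?] [? ? ?]; split; split=> //; rewrite lorentzC.
have [|||//|//] :=
  frame_third_unique (w := u (ordS (ordS j))) fp' _ _ _ (unit _) => //.
- by rewrite lorentzC top_upper.
- by rewrite lorentzC upper_upper.
Qed.

Lemma upper_prev_neq0 j q :
  lorentz_frame t (u (ordS j)) (u (ordS (ordS j))) q -> lorentz (u j) q != 0.
Proof.
move=> fq; apply/eqP => h; have [ne neN] := upper_neq j.
have [|||h'|h'] := frame_third_unique (w := u j) fq _ _ _ (unit _) => //.
- by rewrite lorentzC top_upper.
- by rewrite upper_upper.
- by apply: ne.
- by apply: neN; rewrite h' opprK.
Qed.

(** The foot of the perpendicular from a point of the top face to the plane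
    of an upper pentagon lies between the two vertices of their common edge. *)
Lemma upper_projection i x f :
  polyhedron e x -> lorentz x t = 0 ->
  lorentz (x - lorentz x (u i) *: u i) (e f) <= 0.
Proof.
move=> [hx px] xt.
have [j ij] : exists j, i = ordS j by exists (ord_pred i); rewrite ord_predK.
subst i; pose k := ordS (ordS j).
have [p [hp pp] fp] := upper_vertex j.
have [q [hq pq] fq] := upper_vertex (ordS j).
have [_ [_ _ fp12] [fp1 fp2 fp3]] := fp.
have [_ [_ _ fq12] [fq1 fq2 fq3]] := fq.
have pk : lorentz p (u k) < 0.
  by rewrite lt_neqAle (pp (Upper k)) andbT lorentzC upper_next_neq0.
have qj : lorentz q (u j) < 0.
  by rewrite lt_neqAle (pq (Upper j)) andbT lorentzC upper_prev_neq0.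
pose i := ordS j; rewrite -/i.
pose y := x - lorentz x (u i) *: u i.
have yt : lorentz y t = 0.
  by rewrite /y !lorentz_lin xt (lorentzC (u i)) top_upper; ring.
have yi : lorentz y (u i) = 0 by rewrite /y !lorentz_lin unit; ring.
have yj : lorentz y (u j) <= 0.
  rewrite /y !lorentz_lin (lorentzC (u i)) upper_upper.
  by have := px (Upper j); rewrite -/(u j); lra.
have yk : lorentz y (u k) <= 0.
  rewrite /y !lorentz_lin upper_upper.
  by have := px (Upper k); rewrite -/(u k); lra.
rewrite -/y; clearbody y.
(* y lies in the plane spanned by the vertices p and q, and each coefficient is
   read off on the normal that vanishes at the other vertex. *)
pose a := lorentz y (u k) / lorentz p (u k).
pose c := lorentz y (u j) / lorentz q (u j).
have a0 : 0 <= a by rewrite /a -mulrNN -invrN divr_ge0 ?oppr_ge0 // ltW.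
have c0 : 0 <= c by rewrite /c -mulrNN -invrN divr_ge0 ?oppr_ge0 // ltW.
have yE : y = a *: p + c *: q.
  apply/eqP; rewrite -subr_eq0; apply/eqP; set d := y - _.
  have dt : lorentz d t = 0.
    by rewrite /d !lorentz_lin yt (lorentzC p) (lorentzC q) fp1 fq1; ring.
  have di : lorentz d (u i) = 0.
    by rewrite /d !lorentz_lin yi (lorentzC p) (lorentzC q) fp3 fq2; ring.
  have dj : lorentz d (u j) = 0.
    rewrite /d !lorentz_lin (lorentzC p) fp2 /c; field.
    by rewrite lt_eqF.
  have dk : lorentz d (u k) = 0.
    rewrite /d !lorentz_lin (lorentzC q) fq3 /a; field.
    by rewrite lt_eqF.
  clearbody d; have := frame_expand d fp; rewrite dt dj di !scale0r !add0r => dE.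
  move: dk; rewrite dE !lorentz_lin => /eqP.
  rewrite oppr_eq0 mulf_eq0 (lt_eqF pk) orbF => /eqP ->.
  by rewrite scale0r oppr0.
rewrite yE !lorentz_lin.
have := mulr_ge0_le0 a0 (pp f); have := mulr_ge0_le0 c0 (pq f); lra.
Qed.

(** The foot of the perpendicular to U_i from a vertex x of U_j satisfies the
    inequality of U_j only if <x, u_i> <u_i, u_j> is nonnegative. *)
Lemma upper_le0 i j : i != j -> lorentz (u i) (u j) <= 0.
Proof.
move=> ij; rewrite leNgt; apply/negP => h.
have ij1 : lorentz (u i) (u j) < 1.
  by apply: (normals_lt1 hre) => -[] /eqP; rewrite (negbTE ij).
(* Both vertices of the edge of U_j with the top would lie on U_i. *)
have vi x : polyhedron e x -> lorentz x t = 0 -> lorentz x (u j) = 0 ->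
    lorentz (u i) x = 0.
  move=> hx xt xj; have := upper_projection i (Upper j) hx xt.
  rewrite -/(u j) !lorentz_lin xj => h1.
  case: hx => _ /(_ (Upper i)); rewrite -/(u i) (lorentzC _ x) => h2.
  by apply/eqP; rewrite eq_le h2 /=; nra.
have [k jk] : exists k, j = ordS k by exists (ord_pred j); rewrite ord_predK.
subst j; pose l := ordS (ordS k).
have [p pp fp] := upper_vertex k.
have [q pq fq] := upper_vertex (ordS k).
have [_ [_ _ fp12] [fp1 fp2 fp3]] := fp.
have [_ [_ _ fq12] [fq1 fq2 fq3]] := fq.
have ip : lorentz (u i) p = 0 by apply: vi => //; rewrite lorentzC.
have iq : lorentz (u i) q = 0 by apply: vi => //; rewrite lorentzC.
have it : lorentz (u i) t = 0 by rewrite lorentzC top_upper.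
have := congr1 (lorentz p) (frame_expand (u i) fq).
rewrite !(lorentzC p) ip it iq !scale0r add0r subr0 lorentzDl !lorentzZl.
rewrite fp3 mulr0 add0r => /esym/eqP.
rewrite mulf_eq0 (negbTE (upper_next_neq0 fp)) orbF => /eqP il.
have := frame_lorentz (u i) (u i) fq; rewrite unit iq it il; nra.
Qed.

(** * Crowding of the upper pentagons around the common perpendicular *)

(** In a frame made of b, the two lower neighbours of U_i and their common
    point with b, the relation <t, u_i> = 0 becomes an equation for <b, u_i>. *)
Lemma bottom_upper_bound i : lorentz b (u i) ^+ 2 <= lorentz t b ^+ 2 + 1.
Proof.
have [x [hx _]] := hdim_point (poly_dim hre).
have := frame_point (unit (Bottom n)) (unit (Lower i)) (unit (Lower (ordS i)))
  (bottom_lower i) (bottom_lower _) (lower_lower i) hx.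
move=> [p [_ _ [_ fp _]]].
have := frame_lorentz (u i) (u i) fp; have := frame_lorentz t t fp.
have := frame_lorentz t (u i) fp.
rewrite -/(v i) -/(v (ordS i)) -/b upper_lower upper_lowerS top_upper !unit.
rewrite (lorentzC (u i) b) => h1 h2 h3.
have := top_lower i; have := top_lower (ordS i).
move: h1 h2 h3; set C := lorentz t b; set B := lorentz b (u i).
set s := lorentz (u i) p; set g := lorentz t p.
move: (lorentz t (v i)) (lorentz t (v (ordS i))) => A A' h1 h2 h3 a' a.
have h4 : g ^+ 2 * s ^+ 2 = C ^+ 2 * B ^+ 2.
  by rewrite -!exprMn; congr (_ ^+ 2); lra.
have h5 : C ^+ 2 + 1 <= g ^+ 2 by nra.
have h6 : (C ^+ 2 + 1) * s ^+ 2 <= C ^+ 2 * B ^+ 2.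
  by rewrite -h4 ler_wpM2r ?sqr_ge0.
have h7 : s ^+ 2 = B ^+ 2 - 1 by lra.
by move: h6; rewrite h7; lra.
Qed.

(** The square of sinh delta_n. *)
Let S2 := lorentz t b ^+ 2 - 1.

Lemma S2_gt0 : 0 < S2.
Proof. by have := top_bottom_lt; rewrite /S2; nra. Qed.

(** The directions of the projections of the u_i to the Euclidean plane
    orthogonal to t and b: they are apart since <u_i, u_j> <= 0. *)
Lemma upper_directions : exists x y : 'I_n -> R,
  (forall i, x i ^+ 2 + y i ^+ 2 = 1) /\
  (forall i j, i != j ->
     S2 / (S2 + 1) <= (x i - x j) ^+ 2 + (y i - y j) ^+ 2).
Proof.
have S0 := S2_gt0; pose S := Num.sqrt S2.
have Sn0 : S != 0 by rewrite gt_eqF ?sqrtr_gt0.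
have SS : S ^+ 2 = S2 by rewrite sqr_sqrtr ?ltW.
pose c := S^-1 *: (b - lorentz t b *: t).
have cc : lorentz c c = -1.
  rewrite /c !lorentz_lin !unit (lorentzC b t).
  transitivity (- (S ^- 2 * S2)); first by rewrite -exprVn /S2; ring.
  by rewrite -SS mulVf ?expf_neq0.
have tc : lorentz t c = 0 by rewrite /c !lorentz_lin unit; ring.
have uc i : lorentz (u i) c = lorentz b (u i) / S.
  rewrite /c !lorentz_lin !(lorentzC (u i)) top_upper; ring.
clearbody c.
have [f [g fr]] := frame_complete (unit (Top n)) cc tc (unit (Upper i0))
  (unit (Upper (ordS i0))) (upper_upper i0) (top_upper i0) (top_upper _).
have c1 i : 0 < 1 + lorentz (u i) c ^+ 2.
  by have := sqr_ge0 (lorentz (u i) c); lra.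
pose s i := (Num.sqrt (1 + lorentz (u i) c ^+ 2))^-1.
have ss i : s i ^+ 2 = (1 + lorentz (u i) c ^+ 2)^-1.
  by rewrite /s exprVn sqr_sqrtr ?ltW.
have s0 i : 0 < s i by rewrite invr_gt0 sqrtr_gt0.
have ut i : lorentz (u i) t = 0 by rewrite lorentzC top_upper.
have uu i : lorentz (u i) f ^+ 2 + lorentz (u i) g ^+ 2 = 1 + lorentz (u i) c ^+ 2.
  have := frame_lorentz (u i) (u i) fr; rewrite -/t ut unit; lra.
exists (fun i => s i * lorentz (u i) f), (fun i => s i * lorentz (u i) g).
split=> [i|i j ij].
  by rewrite !exprMn -mulrDr uu ss mulVf ?gt_eqF.
(* The inner product of two directions is at most r_i r_j, hence at most the
   mean of r_i^2 and r_j^2, and r_i is away from 1 as <u_i, c> is bounded. *)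
pose r i := s i * lorentz (u i) c.
have r2 k : r k ^+ 2 = 1 - s k ^+ 2.
  by rewrite /r exprMn ss; field; rewrite gt_eqF // c1.
have sk k : S2 / (S2 + 1) <= 2 * s k ^+ 2.
  have hB := bottom_upper_bound k.
  have : 1 + lorentz (u k) c ^+ 2 <= 2 * ((S2 + 1) / S2).
    rewrite uc expr_div_n SS -[X in X + _](divff (lt0r_neq0 S0)) -mulrDl mulrA.
    by rewrite ler_pM2r ?invr_gt0 // /S2; lra.
  have S10 : 0 < (S2 + 1) / S2 by rewrite divr_gt0 //; lra.
  rewrite ss -[S2 / _]invf_div => h.
  by rewrite ler_pdivlMr // mulrC ler_pdivrMr.
have rr : s i * s j * (lorentz (u i) f * lorentz (u j) f +
    lorentz (u i) g * lorentz (u j) g) <= r i * r j.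
  have -> : r i * r j = s i * s j * (lorentz (u i) c * lorentz (u j) c).
    by rewrite /r; ring.
  rewrite ler_pM2l ?mulr_gt0 //.
  have := frame_lorentz (u i) (u j) fr; rewrite -/t !ut.
  by have := upper_le0 ij; lra.
have hi : (s i * lorentz (u i) f) ^+ 2 + (s i * lorentz (u i) g) ^+ 2 = 1.
  by rewrite !exprMn -mulrDr uu ss mulVf ?gt_eqF.
have hj : (s j * lorentz (u j) f) ^+ 2 + (s j * lorentz (u j) g) ^+ 2 = 1.
  by rewrite !exprMn -mulrDr uu ss mulVf ?gt_eqF.
have := sqr_ge0 (r i - r j); have := r2 i; have := r2 j.
have := sk i; have := sk j; lra.
Qed.

Lemma S2_small m : (1 < m)%N -> (m.*2.+1 ^ 2 < n)%N -> S2 <= 4 / m%:R ^+ 2.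
Proof.
move=> m1 hn; have [x [y [xy1 xyd]]] := upper_directions.
have le1 (p q : R) : p ^+ 2 + q ^+ 2 = 1 -> `|p| <= 1.
  move=> h; rewrite -(ler_pXn2r (n := 2)) ?nnegrE // expr1n real_normK ?num_real //.
  by have := sqr_ge0 q; lra.
have [i [j [ij h1 h2]]] := pigeonhole_square (ltnW m1) hn
  (fun i => le1 _ _ (xy1 i)) (fun i => le1 _ _ (etrans (addrC _ _) (xy1 i))).
have m2 : (2 : R) <= m%:R by rewrite ler_nat.
have h := xyd i j ij; have S0 := S2_gt0.
have mm : 0 < m%:R ^+ 2 :> R by rewrite exprn_gt0 //; lra.
have : S2 / (S2 + 1) <= 2 / m%:R ^+ 2 by lra.
rewrite ler_pdivrMr; last lra.
rewrite mulrAC ler_pdivlMr // => h3.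
have m4 : 4 <= m%:R ^+ 2 :> R by rewrite expr2; nra.
have := ler_wpM2l (ltW S0) m4; rewrite ler_pdivlMr //; lra.
Qed.

Lemma bottom_le0 g : g <> Bottom n -> lorentz b (e g) <= 0.
Proof.
case: g => [[]|[[] i]] // _.
- by have := top_bottom_lt; rewrite lorentzC -/(Top n) -/t; lra.
- by have := bottom_upper i; rewrite -/(Upper i) /u; lra.
- by have := bottom_lower i; rewrite -/(Lower i) /v => ->.
Qed.

(** The common perpendicular of the planes of top and bottom has its feet in
    the two faces and length arcosh (- <t, b>). *)
Lemma lobell_delta_bounds : 0 <= lobell_delta e <= 2 * Num.sqrt S2.
Proof.
have tb := top_bottom_lt; have S0 := S2_gt0.
have bt : lorentz (e (Bottom n)) (e (Top n)) < -1 by rewrite lorentzC.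
have [k k0 [ft kS]] := common_perpendicular_foot hre tb top_le0 bottom_le0.
rewrite -/t -/b -/S2 in ft kS.
have [l l0 []] := common_perpendicular_foot hre bt bottom_le0 top_le0.
rewrite (lorentzC (e (Bottom n))) -/t -/b -/S2 => fb lS.
have kl : k = l.
  apply/eqP; rewrite -(eqrXn2 (n := 2)) ?ltW //; apply/eqP.
  by apply: (mulIf (lt0r_neq0 S0)); rewrite kS lS.
subst l.
set E := [set d | exists x y,
  [/\ face e (Top n) x, face e (Bottom n) y & d = hdist x y]].
have lbE : lbound E 0.
  move=> d [x [y [[[hx _] _] [[hy _] _] ->]]].
  by apply: arcosh_ge0; have := H3_lorentz_leN1 hx hy; lra.
have Earcosh : E (arcosh (- lorentz t b)).
  exists (k *: (b - lorentz t b *: t)), (k *: (t - lorentz t b *: b)).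
  split=> //; rewrite /hdist; congr (arcosh (- _)).
  rewrite !lorentz_lin !unit (lorentzC b t).
  transitivity (k ^+ 2 * S2 * lorentz t b); first by rewrite kS mul1r.
  by rewrite /S2; ring.
apply/andP; split; first by apply: lb_le_inf => //; exists (arcosh (- lorentz t b)).
apply: (le_trans (ge_inf _ Earcosh)); first by exists 0.
by rewrite /S2 -sqrrN; apply: arcosh_le; lra.
Qed.

End Lobell.

Unset Implicit Arguments.

Theorem mainTheorem3 (R : realType)
    (L : forall n : nat, lobell_face n -> 'rV[R]_4)
    (hL : forall n : nat, (5 <= n)%N -> is_lobell (L n)) :
  lobell_delta (L n) @[n --> \oo] --> (0 : R).
Proof.
apply/cvgrPdist_le => eps eps0.
pose m := (Num.truncn (4 / eps)).+2.
have mR : 4 / eps <= m%:R.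
  have /andP[_ h] := truncn_itv (divr_ge0 (ler0n R 4) (ltW eps0)).
  by apply: (le_trans (ltW h)); rewrite ler_nat.
have m0 : 0 < m%:R :> R by rewrite ltr0n.
near=> n.
have n5 : (5 <= n)%N by near: n; exists 5.
have mn : (m.*2.+1 ^ 2 < n)%N by near: n; exists (m.*2.+1 ^ 2).+1.
have n3 : (2 < n)%N by apply: leq_trans n5.
have /andP[d0 d1] := lobell_delta_bounds n3 (hL n n5).
have S2 := S2_small n3 (hL n n5) (isT : (1 < m)%N) mn.
rewrite sub0r normrN ger0_norm //; apply: (le_trans d1).
rewrite (_ : eps = 2 * (eps / 2)) ?ler_pM2l //; last by field.
have h2 : 2 / m%:R <= eps / 2 by move: mR; rewrite !ler_pdivrMr //; lra.
apply: le_trans h2; rewrite -[leRHS]ger0_norm ?divr_ge0 // -sqrtr_sqr.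
by rewrite ler_wsqrtr // expr_div_n -natrX.
Unshelve. all: by end_near.
Qed.
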